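(* Let $p,q\in S^{\mathrm{EM}}$. \begin{enumerate} \item If $p\leq^{\mathrm{div}} q$, then $p\leq^{\#} q$. \item If $T$ is $\mathrm{NTP}_2$ and $p\leq^{\#} q$, then $p\leq^{\mathrm{div}} q$. \end{enumerate}
   Context: $T$ is a complete first-order theory in a language $L$, and we work in a monster model $\mathbb{M}\models T$. $\mathrm{NTP}_2$: a formula $\varphi(x,y)$ is $\mathrm{TP}_2$ if there are $(a_{ij})_{i,j\in\omega}$ and $k\in\omega$ such that $\{\varphi(x,a_{ij})\}_{j\in\omega}$ is $k$-inconsistent for each $i\in\omega$, while $\{\varphi(x,a_{if(i)})\}_{i\in\omega}$ is consistent for each $f:\omega\to\omega$. $T$ is $\mathrm{NTP}_2$ if no formula is $\mathrm{TP}_2$. $S^{\mathrm{EM}}$ is the set of Ehrenfeucht–Mostowski types over $\emptyset$ of indiscernible sequences of singletons (for simplicity of notation only $1$-types are considered); for $p\in S^{\mathrm{EM}}$, an infinite sequence realizes $p$ (written $\bar a\models p$) if it is indiscernible with EM type $p$. For $p\in S^{\mathrm{EM}}$, $\mathrm{cl}^{\mathrm{div}}(p)$ is the set of all $L$-formulas $\varphi(x,y)$ such that for some (equivalently, any) infinite indiscernible sequence $\bar a=(a_i)_{i\in\omega}\models p$, the set $\{\varphi(a_i,y)\}_{i\in\omega}$ is consistent. For $p,q\in S^{\mathrm{EM}}$, $p\leq^{\mathrm{div}} q$ means $\mathrm{cl}^{\mathrm{div}}(p)\supseteq\mathrm{cl}^{\mathrm{div}}(q)$. $p\leq^{\#}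 q$ means that there is an array $(a_{ij})_{i,j\in\omega}$ such that $(a_{ij})_{j\in\omega}\models p$ for each $i\in\omega$, and $(a_{if(i)})_{i\in\omega}\models q$ for each $f:\omega\to\omega$. *)

(* Defs.v *)
From mathcomp Require Import all_boot.
From mathcomp Require Import boolp classical_sets functions cardinality.

Set Implicit Arguments.
Unset Strict Implicit.
Unset Printing Implicit Defensive.

Local Open Scope classical_set_scope.
Local Open Scope card_scope.

Record language := Language {
  fsym : Type;
  farity : fsym -> nat;
  rsym : Type;
  rarity : rsym -> nat }.

(* Well-scoped de Bruijn syntax: the free variables of a term or formula of
   index n are the elements of 'I_n. *)
Inductive term (L : language) (n : nat) : Type :=
| Var of 'I_n
| Fun (f : fsym L) of ('I_(farity f) -> term L n).

(* In All phi the variable ord0 of phi is bound, and the variable lift ord0 i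
   of phi is the variable i of All phi. *)
Inductive formula (L : language) : nat -> Type :=
| Falsum n : formula L n
| Eq n : term L n -> term L n -> formula L n
| Rel n (r : rsym L) : ('I_(rarity r) -> term L n) -> formula L n
| Imp n : formula L n -> formula L n -> formula L n
| All n : formula L n.+1 -> formula L n.

Arguments Falsum {L n}.

Record structure (L : language) := Structure {
  carrier :> Type;
  carrier_nonempty : inhabited carrier;
  finterp : forall f : fsym L, (farity f).-tuple carrier -> carrier;
  rinterp : forall r : rsym L, (rarity r).-tuple carrier -> Prop }.

Section Satisfaction.
Variables (L : language) (M : structure L).

Fixpoint eval n (v : n.-tuple M) (t : term L n) : M :=
  match t with
  | Var i => tnth v i
  | Fun f ts => finterp [tuple eval v (ts i) | i < farity f]
  end.

Fixpoint sat n (phi : formula L n) : n.-tuple M -> Prop :=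
  match phi in formula _ n return n.-tuple M -> Prop with
  | Falsum _ => fun=> False
  | Eq _ t u => fun v => eval v t = eval v u
  | Rel _ r ts => fun v => rinterp [tuple eval v (ts i) | i < rarity r]
  | Imp _ phi psi => fun v => sat phi v -> sat psi v
  | All _ phi => fun v => forall x : M, sat phi [tuple of x :: v]
  end.

End Satisfaction.

Section Theories.
Variable L : language.

Definition theory := set (formula L 0).

Definition models (M : structure L) (T : theory) :=
  forall phi, T phi -> sat phi ([tuple] : 0.-tuple M).

Definition entails (T : theory) (phi : formula L 0) :=
  forall N : structure L, models N T -> sat phi ([tuple] : 0.-tuple N).

Definition complete_theory (T : theory) :=
  (exists N : structure L, models N T) /\
  forall phi, entails T phi \/ entails T (Imp phi Falsum).

End Theories.

Section Monster.
Variables (L : language) (M : structure L).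

(* Strict inequality of cardinals, between a set and the type K. *)
Definition card_below (U : Type) (A : set U) (K : Type) : Prop :=
  A #<= [set: K] /\ ~ ([set: K] #<= A).

Definition all_formulas : set {n & formula L n} := setT.

(* A formula with parameters from M, in m free variables: a formula in m + n
   variables together with the values of the last n. *)
Definition pformula (m : nat) :=
  {n : nat & (formula L (m + n) * n.-tuple M)%type}.

Definition psat m (psi : pformula m) (x : m.-tuple M) : Prop :=
  sat (projT2 psi).1 [tuple of x ++ (projT2 psi).2].

Definition params_in m (A : set M) (psi : pformula m) : Prop :=
  forall i, A (tnth (projT2 psi).2 i).

Definition realized m (Sigma : set (pformula m)) : Prop :=
  exists x : m.-tuple M, forall psi, Sigma psi -> psat psi x.

Definition finitely_satisfiable m (Sigma : set (pformula m)) : Prop :=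
  forall Delta, finite_set Delta -> Delta `<=` Sigma -> realized Delta.

Definition saturated (K : Type) : Prop :=
  forall A : set M, card_below A K ->
  forall Sigma : set (pformula 1), Sigma `<=` params_in A ->
    finitely_satisfiable Sigma -> realized Sigma.

Definition elementary_on (A : set M) (f : M -> M) : Prop :=
  forall n (phi : formula L n) (v : n.-tuple M), (forall i, A (tnth v i)) ->
    (sat phi v <-> sat phi [tuple of map f v]).

Definition automorphism (g : M -> M) : Prop :=
  [/\ bijective g,
      forall (f : fsym L) v, g (finterp (f := f) v) =
        finterp (f := f) [tuple of map g v] &
      forall (r : rsym L) v, rinterp (r := r) v <->
        rinterp (r := r) [tuple of map g v]].

Definition strongly_homogeneous (K : Type) : Prop :=
  forall A : set M, card_below A K ->
  forall f, elementary_on A f ->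
    exists2 g, automorphism g & forall x, A x -> g x = f x.

(* K stands for a cardinal kappa > |L| + aleph_0, the latter being the number
   of L-formulas. *)
Definition monster (K : Type) : Prop :=
  [/\ card_below all_formulas K, saturated K & strongly_homogeneous K].

End Monster.

Section Main.
Variables (L : language) (M : structure L).

(* A family of conditions on an m-tuple from M; in the monster model,
   consistent means realized in M. *)
Definition consistent m (I : Type) (Phi : I -> set (m.-tuple M)) : Prop :=
  exists x, forall i, Phi i x.

Definition k_inconsistent m (k : nat) (Phi : nat -> set (m.-tuple M)) : Prop :=
  forall s : k.-tuple nat, uniq s ->
    ~ consistent (fun l : 'I_k => Phi (tnth s l)).

(* phi(x, y) with x an m-tuple and y an n-tuple of variables. *)
Definition TP2 m n (phi : formula L (m + n)) : Prop :=
  exists (a : nat -> nat -> n.-tuple M) (k : nat),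
    (forall i, k_inconsistent k
       (fun j => [set x : m.-tuple M | sat phi [tuple of x ++ a i j]])) /\
    (forall f : nat -> nat, consistent
       (fun i => [set x : m.-tuple M | sat phi [tuple of x ++ a i (f i)]])).

Definition NTP2 : Prop := forall m n (phi : formula L (m + n)), ~ TP2 phi.

Definition indiscernible (a : nat -> M) : Prop :=
  forall n (phi : formula L n) (s t : n.-tuple nat),
    sorted ltn s -> sorted ltn t ->
    (sat phi [tuple of map a s] <-> sat phi [tuple of map a t]).

Definition em_type := forall n, set (formula L n).

Definition EM (a : nat -> M) : em_type := fun n =>
  [set phi | forall s : n.-tuple nat, sorted ltn s ->
               sat phi [tuple of map a s]].

Definition realizes (a : nat -> M) (p : em_type) : Prop :=
  indiscernible a /\ EM a = p.

Definition S_EM : set em_type := [set p | exists a, realizes a p].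

(* phi(x, y) with x a single variable and y an n-tuple of variables. *)
Definition cl_div (p : em_type) : set {n & formula L (1 + n)} :=
  [set phi | exists2 a, realizes a p &
     consistent (fun i => [set y : (projT1 phi).-tuple M |
       sat (projT2 phi) [tuple of [tuple a i] ++ y]])].

Definition le_div (p q : em_type) : Prop := cl_div q `<=` cl_div p.

Definition le_sharp (p q : em_type) : Prop :=
  exists a : nat -> nat -> M,
    (forall i, realizes (a i) p) /\
    (forall f : nat -> nat, realizes (fun i => a i (f i)) q).

End Main.

(* Main.v *)
Require Import Defs.
From mathcomp Require Import all_boot.
From mathcomp Require Import boolp classical_sets functions cardinality.
From mathcomp Require Import zify.

(** Both implications rest on one compactness principle: countably many
    elements of a monster model can be chosen so as to satisfy any directed
    family of definable conditions, provided that each condition can be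
    satisfied separately ([compactness]).  The variables are chosen one at a
    time.  Each choice is an instance of saturation for one variable over a
    countable set of parameters, because existence of the remaining finitely
    many variables of one condition is again a formula.

    From [p <=div q] to [p <=# q].  Arrays are built such that all paths realize
    [q] and the first [n] rows realize [p], by induction on [n]; compactness
    then gives the array all of whose rows realize [p].  For [n = 0], take an
    array with constant rows, read off a realization of [q].  For the step
    ([add_row]), given such an array [A], fix finitely many of the conditions to
    be met and let [psi(x, y)] say that they hold when every entry of row [n]
    is [x] and the other entries are named by [y].  The sequence
    [A (n, 0), A (n + 1, 0), ...] realizes [q], and its first [N] terms have a
    common solution [y] of [psi]: keep the rows below [n], and let the rows
    after row [n] be those that come [N] later in [A], so that each of the [N]
    candidates for [x] still precedes them.  Hence [psi] belongs to [cl_div q],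
    so to [cl_div p], which provides a realization [a] of [p] and one [y] that
    works for every [x = a j].  Using [a] as row [n] is then correct, as a path
    meets this row in one entry only.

    From [p <=# q] to [p <=div q] under NTP2.  Suppose that [psi] lies in
    [cl_div q] but not in [cl_div p], and take the array given by [p <=# q].
    Along each path the formulas [psi(a_ij, y)] are consistent, since the path
    realizes [q]; in each row some fixed finite number of them is inconsistent,
    by compactness, and by indiscernibility it does not matter which ones.
    Thus [psi], with the roles of its variables exchanged, has TP2. *)

Set Implicit Arguments.
Unset Strict Implicit.
Unset Printing Implicit Defensive.

Local Open Scope classical_set_scope.
Local Open Scope card_scope.

(** * Renaming and finite blocks of existential quantifiers *)

Section Syntax.
Variable L : language.

Fixpoint rename_term n m (r : 'I_n -> 'I_m) (t : term L n) : term L m :=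
  match t with
  | Var i => Var L (r i)
  | Defs.Fun f ts => Defs.Fun (fun k => rename_term r (ts k))
  end.

Definition lift_renaming n m (r : 'I_n -> 'I_m) (k : 'I_n.+1) : 'I_m.+1 :=
  if unlift ord0 k is Some j then lift ord0 (r j) else ord0.

Fixpoint rename n (phi : formula L n) : forall m, ('I_n -> 'I_m) -> formula L m :=
  match phi in formula _ n return forall m, ('I_n -> 'I_m) -> formula L m with
  | Falsum _ => fun _ _ => Falsum
  | Eq _ t u => fun _ r => Eq (rename_term r t) (rename_term r u)
  | Rel _ R ts => fun _ r => Rel (fun k => rename_term r (ts k))
  | Imp _ phi psi => fun _ r => Imp (rename phi r) (rename psi r)
  | All _ phi => fun _ r => All (rename phi (lift_renaming r))
  end.

Definition Not n (phi : formula L n) := Imp phi Falsum.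
Definition And n (phi psi : formula L n) := Not (Imp phi (Not psi)).

Fixpoint Exists m n : formula L (m + n) -> formula L n :=
  match m return formula L (m + n) -> formula L n with
  | 0 => id
  | m'.+1 => fun phi => Exists (Not (All (Not phi)))
  end.

Variable M : structure L.

Lemma eval_rename n m (r : 'I_n -> 'I_m) (t : term L n) (w : m.-tuple M) :
  eval w (rename_term r t) = eval [tuple tnth w (r k) | k < n] t.
Proof.
elim: t => [i|f ts IH] /=; first by rewrite tnth_mktuple.
by congr finterp; apply: eq_from_tnth => k; rewrite !tnth_mktuple.
Qed.

Lemma sat_rename n (phi : formula L n) m (r : 'I_n -> 'I_m) (w : m.-tuple M) :
  sat (rename phi r) w <-> sat phi [tuple tnth w (r k) | k < n].
Proof.
elim: phi m r w => {n} [n|n t u|n R ts|n phi IHphi psi IHpsi|n phi IH] m r w //=.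
- by rewrite !eval_rename.
- suff -> : [tuple eval w (rename_term r (ts i)) | i < rarity R] =
    [tuple eval [tuple tnth w (r k) | k < n] (ts i) | i < rarity R] by [].
  by apply: eq_from_tnth => k; rewrite !tnth_mktuple eval_rename.
- by rewrite IHphi IHpsi.
- have E x : [tuple tnth [tuple of x :: w] (lift_renaming r k) | k < n.+1] =
      [tuple of x :: [tuple tnth w (r k) | k < n]].
    apply: eq_from_tnth => k; rewrite tnth_mktuple /lift_renaming.
    by case: unliftP => [j|] ->; rewrite ?tnth0 // !tnthS tnth_mktuple.
  by split=> H x; move/(_ x): H; rewrite IH E.
Qed.

Lemma sat_And n (phi psi : formula L n) (w : n.-tuple M) :
  sat (And phi psi) w <-> sat phi w /\ sat psi w.
Proof.
split=> /= [H|[h1 h2] /(_ h1)]; last exact.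
by split; apply: contrapT => h; apply: H => // h1 ?; apply: h.
Qed.

Lemma sat_Exists m n (phi : formula L (m + n)) (w : n.-tuple M) :
  sat (Exists phi) w <-> exists y : m.-tuple M, sat phi [tuple of y ++ w].
Proof.
elim: m phi => [|m IH] phi.
  split=> [H|[y]]; first by exists [tuple]; congr (sat _ _): H; exact: val_inj.
  by congr (sat _ _); rewrite (tuple0 y); exact: val_inj.
rewrite /= IH /=; split=> [[y]|[y H]].
  move/existsNP=> [x /contrapT H]; exists [tuple of x :: y].
  by congr (sat _ _): H; exact: val_inj.
exists [tuple of behead y] => /(_ (thead y)); apply.
congr (sat _ _): H; apply: val_inj => /=.
by rewrite {1}(tuple_eta y).
Qed.

End Syntax.

(** * Definable conditions on families of elements *)

Section Definability.
Variables (L : language) (M : structure L).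

(** The variables range over an arbitrary type [I], so that arrays, and
    sequences extended by a finite tuple, are families like any other.  The map
    [z] need not be injective, which spares listing the variables that occur
    in a condition without repetition. *)
Definition definable (I : Type) (P : (I -> M) -> Prop) : Prop :=
  exists n (phi : formula L n) (z : 'I_n -> I),
    forall a, P a <-> sat phi [tuple a (z k) | k < n].

Lemma definable_sat I n (phi : formula L n) (z : n.-tuple I) :
  definable (fun a : I -> M => sat phi [tuple of map a z]).
Proof.
exists n, phi, (tnth z) => a.
suff -> : [tuple of map a z] = [tuple a (tnth z k) | k < n] by [].
by apply: eq_from_tnth => k; rewrite tnth_map tnth_mktuple.
Qed.

Lemma definable_true I : definable (fun _ : I -> M => True).
Proof.
exists 0, (Imp Falsum Falsum), (fun k : 'I_0 => False_rect I (notF (ltn_ord k))).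
by move=> a; split=> //= _ [].
Qed.

Lemma definable_and I (P Q : (I -> M) -> Prop) :
  definable P -> definable Q -> definable (fun a => P a /\ Q a).
Proof.
move=> [n [phi [z HP]]] [m [psi [u HQ]]].
exists (n + m), (And (rename phi (@lshift n m)) (rename psi (@rshift n m))).
exists (fun k => match fintype.split k with inl i => z i | inr j => u j end) => a.
rewrite sat_And !sat_rename HP HQ.
set b := [tuple _ | k < n + m].
have -> : [tuple tnth b (lshift m k) | k < n] = [tuple a (z k) | k < n].
  apply: eq_from_tnth => k; rewrite !tnth_mktuple.
  by rewrite (unsplitK (inl k : 'I_n + 'I_m)).
have -> // : [tuple tnth b (rshift n k) | k < m] = [tuple a (u k) | k < m].
apply: eq_from_tnth => k; rewrite !tnth_mktuple.
by rewrite (unsplitK (inr k : 'I_n + 'I_m)).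
Qed.

Lemma definable_guard I (C : Prop) (P : (I -> M) -> Prop) :
  definable P -> definable (fun a => C -> P a).
Proof.
case: (pselect C) => [c|nc] dP.
  by case: dP => n [phi [z H]]; exists n, phi, z => a; rewrite -H; split; auto.
by case: (definable_true I) => n [phi [z H]]; exists n, phi, z => a; rewrite -H.
Qed.

Lemma definable_all I (T : eqType) (l : seq T) (F : T -> (I -> M) -> Prop) :
  (forall t, definable (F t)) -> definable (fun a => forall t, t \in l -> F t a).
Proof.
move=> dF; elim: l => [|t l IH].
  by case: (definable_true I) => n [phi [z H]]; exists n, phi, z => a; rewrite -H.
have [n [phi [z H]]] := definable_and (dF t) IH.
exists n, phi, z => a; rewrite -H; split=> [h|[h1 h2] t'].
  by split=> [|t' t'l]; apply: h; rewrite in_cons ?eqxx ?t'l ?orbT.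
by rewrite in_cons => /predU1P[->|/h2].
Qed.

Lemma definable_formula n (P : ('I_n -> M) -> Prop) : definable P ->
  exists phi : formula L n, forall w, sat phi w <-> P (tnth w).
Proof.
move=> [m [phi [z H]]]; exists (rename phi z) => w.
by rewrite sat_rename H.
Qed.

End Definability.

(** * Compactness for countably many variables *)

Section Compactness.
Variables (L : language) (M : structure L).

(** Quantifying out all variables of a definable condition except those fixed
    in advance, those of [J], and the one to be solved for, [i], leaves a
    formula in one variable.  It is to such formulas that saturation applies.
    All positions of [P] get a bound variable, but only those whose variable is
    neither in [J] nor [i] use one, and positions with the same variable must
    share it. *)
Lemma fiber_formula (I : eqType) (J : pred I) (c : I -> M) (i : I)
    (P : (I -> M) -> Prop) : definable P -> ~~ J i ->
  exists psi : pformula M 1, params_in (range c) psi /\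
    forall y, psat psi [tuple y] <->
      exists a, [/\ forall k, J k -> a k = c k, a i = y & P a].
Proof.
move=> [n [phi [z HP]]] nJi.
(* A representative of the positions where the variable [z k] stands. *)
pose idx k : 'I_n := odflt k [pick j | z j == z k].
pose r k : 'I_(n + (1 + n)) :=
  if z k == i then rshift n (lshift n ord0) else
  if J (z k) then rshift n (rshift 1 k) else lshift (1 + n) (idx k).
pose par := [tuple c (z k) | k < n].
exists (existT _ n (Exists (rename phi r), par)); split=> [k|y].
  by exists (z k); rewrite // tnth_mktuple.
have idxP k : z (idx k) = z k.
  by rewrite /idx; case: pickP => [j /eqP|//].
have valr (ys : n.-tuple M) k :
    tnth [tuple of ys ++ [tuple of [tuple y] ++ par]] (r k) =
    if z k == i then y else if J (z k) then c (z k) else tnth ys (idx k).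
  rewrite /r; case: (z k =P i) => _; first by rewrite tnth_rshift tnth_lshift.
  case: ifP => _; last by rewrite tnth_lshift.
  by rewrite !tnth_rshift tnth_mktuple.
rewrite /psat /= sat_Exists; split=> [[ys]|[a [aJ ai Pa]]].
  rewrite sat_rename => H.
  exists (fun t => if t == i then y else if J t then c t else
                   if [pick j | z j == t] is Some j then tnth ys j else c t).
  split=> [k Jk||]; last 1 first.
  - rewrite HP; congr (sat _ _): H; apply: eq_from_tnth => k.
    rewrite !tnth_mktuple valr /idx; case: eqP => // _; case: ifP => // _.
    by case: pickP => [//|/(_ k)]; rewrite eqxx.
  - by case: eqP => [ki|_]; [rewrite -ki Jk in nJi | rewrite Jk].
  - by rewrite eqxx.
exists [tuple a (z k) | k < n]; rewrite sat_rename; move/HP: Pa.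
congr (sat _ _); apply: eq_from_tnth => k; rewrite !tnth_mktuple valr.
case: eqP => [->//|_]; case: ifP => [/aJ//|_].
by rewrite tnth_mktuple idxP.
Qed.

Variable K : Type.
Hypothesis hM : monster M K.

Lemma countable_range_below (I : countType) (c : I -> M) :
  card_below (range c) K.
Proof.
have [[leK nKle] _ _] := hM.
have le : range c #<= @all_formulas L.
  apply: card_le_trans (card_image_le c setT) _.
  apply: card_le_trans (countableP [set: I]) _.
  pose f n := existT (formula L) n (@Falsum L n).
  have injf : {in [set: nat] &, injective f}.
    by move=> n m _ _ /(congr1 (@projT1 _ _)).
  have /card_eqPle[_ /card_le_trans] := inj_card_eq injf; apply.
  exact: subset_card_le.
split; first exact: card_le_trans leK.
by move=> Kle; apply: nKle; exact: card_le_trans le.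
Qed.

(** Finite satisfiability of a directed family amounts to satisfiability of
    each member, so finite subfamilies need not be mentioned. *)
Definition directed X I (F : X -> (I -> M) -> Prop) :=
  forall x1 x2, exists x3, forall a, F x3 a -> F x1 a /\ F x2 a.

Lemma tuple1_eta (T : Type) (y : 1.-tuple T) : y = [tuple thead y].
Proof. by apply: val_inj; case: y => [[|x []]]. Qed.

Section Family.
Variables (I : countType) (X : Type) (F : X -> (I -> M) -> Prop).
Hypotheses (X0 : inhabited X) (dF : forall x, definable (F x)).
Hypothesis dirF : directed F.

Definition finitely_solvable (J : pred I) (c : I -> M) :=
  forall x, exists a, (forall k, J k -> a k = c k) /\ F x a.

Definition update (c : I -> M) i y k := if k == i then y else c k.

Lemma finite_bound (Y : Type) (G : X -> Y) (Delta : set Y) :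
  finite_set Delta -> Delta `<=` range G ->
  exists x, forall a, F x a -> forall y, Delta y ->
    exists2 x', G x' = y & F x' a.
Proof.
move=> /(@finite_seqP {classic Y})[s ->] {Delta}.
elim: s => [|y s IH] sub; first by case: X0 => x; exists x.
have [|x2 H2] := IH.
  by move=> y' /= ys; apply: sub; rewrite /= in_cons ys orbT.
have [x1 _ Ex1] : range G y by apply: sub; rewrite /= mem_head.
have [x H] := dirF x1 x2; exists x => a /H[F1 F2] y' /=.
rewrite in_cons => /predU1P[->|ys]; first by exists x1.
exact: H2.
Qed.

(** One step of the construction.  The condition on [y] when [i] is already
    fixed, which does not depend on solvability, keeps earlier choices
    unchanged when the step is iterated along an enumeration of [I]. *)
Lemma solve_one (J : pred I) (c : I -> M) (i : I) : exists y,
  (J i -> y = c i) /\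
  (finitely_solvable J c ->
   finitely_solvable [pred k | (k == i) || J k] (update c i y)).
Proof.
have [Ji|nJi] := boolP (J i).
  exists (c i); split=> // fsJ x; have [a [aJ Fa]] := fsJ x; exists a.
  split=> // k /=.
  by rewrite /update; case: eqP => [->|_] /= => [_|]; apply: aJ.
have [fsJ|nfs] := pselect (finitely_solvable J c); last by exists (c i).
have /choice[psi psiP] x := fiber_formula c (dF x) nJi.
have [_ sat _] := hM.
have [||y yP] := sat _ (countable_range_below c) (range psi).
- by move=> _ [x _ <-]; case: (psiP x).
- move=> Delta finD sub; have [x H] := finite_bound finD sub.
  have [a [aJ Fa]] := fsJ x.
  exists [tuple a i] => p /(H _ Fa)[x' <- Fx'].
  by apply/(psiP x').2; exists a.
exists (thead y); split=> // _ x.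
have [_ /(_ (thead y))[H _]] := psiP x.
have {H}[|a [aJ ai Fa]] := H.
  by have := yP _ (imageT psi x); rewrite {1}(tuple1_eta y).
exists a; split=> // k /=; rewrite /update.
by case: eqP => [->|_] //= /aJ.
Qed.

(** The variables are fixed one after the other along the enumeration of [I].
    A condition mentions finitely many variables, so whether it holds in the
    limit is decided at the finite stage that has fixed them all, where it is
    still solvable. *)
Theorem compactness (J : pred I) (c : I -> M) :
  finitely_solvable J c ->
  exists a, (forall k, J k -> a k = c k) /\ forall x, F x a.
Proof.
move=> fs0.
have /choice[g gP] (s : pred I * (I -> M) * I) := solve_one s.1.1 s.1.2 s.2.
pose next n (s : pred I * (I -> M)) :=
  if @unpickle I n is Some i then
    ([pred k | (k == i) || s.1 k] : pred I, update s.2 i (g (s, i))) else s.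
pose stage n := iteri n next (J, c).
have stageS n : stage n.+1 = next n (stage n) by [].
have fs n : finitely_solvable (stage n).1 (stage n).2.
  elim: n => [//|n IH]; rewrite stageS /next.
  by case: unpickle => [i|//]; have [_] := gP (stage n, i); apply.
have mono m n k : m <= n -> (stage m).1 k ->
    (stage n).1 k /\ (stage n).2 k = (stage m).2 k.
  move=> /subnK <-; elim: (n - m) => [//|d IH] /IH[Jk <-].
  rewrite addSn stageS /next; case: unpickle => [i|//] /=.
  rewrite Jk orbT /update; split=> //; case: eqP => [ki|//].
  by have [H _] := gP (stage (d + m), i); rewrite H /= -?ki.
have cover k : (stage (pickle k).+1).1 k.
  by rewrite stageS /next pickleK /= eqxx.
pose a k := (stage (pickle k).+1).2 k.
exists a; split=> [k Jk|x]; first by have [] := mono 0 (pickle k).+1 k isT Jk.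
have [n [phi [z HP]]] := dF x.
pose N := \max_(k < n) (pickle (z k)).+1.
have [a' [aJ /HP Fa']] := fs N x.
apply/HP; congr (sat _ _): Fa'; apply: eq_from_tnth => k; rewrite !tnth_mktuple.
have [JN aN] := mono _ N (z k) (leq_bigmax k) (cover (z k)).
by rewrite aJ.
Qed.

End Family.
End Compactness.

(** * Ehrenfeucht-Mostowski types and their closures *)

Section EMTypes.
Variables (L : language) (M : structure L).
Implicit Types (p : em_type L).

Lemma realizes_sat p (a : nat -> M) n (phi : formula L n) (s : n.-tuple nat) :
  realizes a p -> sorted ltn s -> (p n phi <-> sat phi [tuple of map a s]).
Proof.
move=> [ind <-] ss; split=> [|H t st]; first exact.
by apply/(ind _ phi s t).
Qed.

(** Since the type of an indiscernible sequence decides every formula, a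
    sequence satisfying all formulas of [p] satisfies no others, and its
    indiscernibility comes for free. *)
Lemma realizes_of_sat p (a : nat -> M) : S_EM M p ->
  (forall n (phi : formula L n) (s : n.-tuple nat),
     p n phi -> sorted ltn s -> sat phi [tuple of map a s]) ->
  realizes a p.
Proof.
move=> [b rb] H.
have sat_p n (phi : formula L n) (s : n.-tuple nat) :
    sorted ltn s -> (sat phi [tuple of map a s] <-> p n phi).
  move=> ss; split=> [sa|/H]; last exact.
  have srt : sorted ltn (iota_tuple n 0) := iota_ltn_sorted 0 n.
  apply/(realizes_sat phi rb srt).
  apply: contrapT => nsb; apply: (H n (Not phi) s) => //.
  exact/(realizes_sat (Not phi) rb srt).
split=> [n phi s t ss st|]; first by rewrite !sat_p.
apply: functional_extensionality_dep => n; apply/predeqP => phi.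
split=> [|pphi s ss]; last exact/sat_p.
by move=> /(_ (iota_tuple n 0) (iota_ltn_sorted 0 n)) /sat_p; apply;
  exact: iota_ltn_sorted.
Qed.

Definition with_params m (x : M) (y : m.-tuple M) := [tuple of [tuple x] ++ y].

(** Having a common solution [y] is a first-order property of finitely many
    elements, hence is transferred between sequences with the same type. *)
Lemma exists_common m (psi : formula L (1 + m)) N : exists theta : formula L N,
  forall w : N.-tuple M, sat theta w <->
    exists y : m.-tuple M, forall i, sat psi (with_params (tnth w i) y).
Proof.
pose z (i : 'I_N) : (1 + m).-tuple 'I_(m + N) :=
  [tuple of [tuple rshift m i] ++ [tuple @lshift m N k | k < m]].
have [|chi chiP] := @definable_formula L M (m + N) (fun u =>
    forall i : 'I_N, i \in enum 'I_N -> sat psi [tuple of map u (z i)]).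
  by apply: definable_all => i; exact: definable_sat.
exists (Exists chi) => w; rewrite sat_Exists.
have E (y : m.-tuple M) i :
    [tuple of map (tnth [tuple of y ++ w]) (z i)] = with_params (tnth w i) y.
  apply: val_inj; rewrite /= tnth_rshift; congr (_ :: _).
  rewrite -map_comp -[RHS](map_tnth_enum y).
  by apply: eq_map => k /=; rewrite tnth_lshift.
split=> -[y Hy]; exists y.
  by move=> i; rewrite -E; move/chiP: Hy; apply; rewrite mem_enum.
by apply/chiP => i _; rewrite E.
Qed.

Variable K : Type.
Hypothesis hM : monster M K.

Lemma common_solution m (psi : formula L (1 + m)) (b : nat -> M) :
  (forall N, exists y : m.-tuple M, forall i, i < N -> sat psi (with_params (b i) y)) ->
  exists y : m.-tuple M, forall i, sat psi (with_params (b i) y).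
Proof.
move=> H.
pose z i : (1 + m).-tuple (nat + 'I_m) :=
  [tuple of [tuple inl i] ++ [tuple inr k | k < m]].
pose F N (a : nat + 'I_m -> M) :=
  forall i, i \in iota 0 N -> sat psi [tuple of map a (z i)].
pose c (t : nat + 'I_m) := if t is inl i then b i else b 0.
pose J (t : nat + 'I_m) := if t is inl i then true else false.
have E a (i : nat) : (forall k, J k -> a k = c k) ->
    [tuple of map a (z i)] = with_params (b i) [tuple a (inr k) | k < m].
  move=> aJ; apply: val_inj => /=; rewrite aJ //; congr (_ :: _).
  by rewrite -map_comp.
have [||||a [aJ Fa]] := @compactness L M K hM _ nat F _ _ _ J c.
- exact: (inhabits 0).
- by move=> N; apply: definable_all => i; exact: definable_sat.
- move=> N1 N2; exists (maxn N1 N2) => a Fa; split=> i iN; apply: Fa;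
    move: iN; rewrite !mem_iota; lia.
- move=> N; have [y Hy] := H N.
  exists (fun t => match t with inl i => b i | inr k => tnth y k end).
  split; first by case.
  move=> i; rewrite mem_iota => iN; rewrite E; last by case.
  rewrite (_ : [tuple _ | k < m] = y); first exact: Hy.
  by apply: eq_from_tnth => k; rewrite tnth_mktuple.
exists [tuple a (inr k) | k < m] => i; rewrite -E //.
by apply: (Fa i.+1); rewrite mem_iota; lia.
Qed.

(** In the definition of [cl_div] the choice of the realization of [p] is
    immaterial: finite consistency is part of [p]. *)
Lemma cl_div_any p a m (psi : formula L (1 + m)) : realizes a p ->
  cl_div M p (existT _ m psi) ->
  exists y : m.-tuple M, forall i, sat psi (with_params (a i) y).
Proof.
move=> ra [b rb [y Hy]]; apply: common_solution => N.
have [theta thP] := exists_common psi N.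
have srt : sorted ltn (iota_tuple N 0) := iota_ltn_sorted 0 N.
have /(realizes_sat theta rb srt) /(realizes_sat theta ra srt) /thP[y' Hy'] :
    sat theta [tuple of map b (iota_tuple N 0)].
  by apply/thP; exists y => i; rewrite tnth_map; exact: Hy.
exists y' => i iN; have := Hy' (Ordinal iN).
by rewrite tnth_map (tnth_nth 0) /= nth_iota.
Qed.

End EMTypes.

(** * Building the array from inclusion of closures *)

Section DivToSharp.
Variables (L : language) (M : structure L) (K : Type).
Hypothesis hM : monster M K.

(** A definable condition involves finitely many variables, so as far as it is
    concerned a family of elements is a finite tuple.  Both translations are
    uniform in the distinguished variable [None], which is what membership
    in [cl_div] requires: one tuple serving for all values of [x]. *)
Lemma split_variable (I : eqType) (G : (option I -> M) -> Prop) : definable G ->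
  exists m (psi : formula L (1 + m)),
    (forall o, exists y : m.-tuple M, forall x,
       G (oapp o x) <-> sat psi (with_params x y)) /\
    (forall y : m.-tuple M, exists o, forall x,
       G (oapp o x) <-> sat psi (with_params x y)).
Proof.
move=> [m [phi [z GP]]]; have [d] := carrier_nonempty M.
pose idx k : 'I_m := odflt k [pick j | z j == z k].
have idxP k : z (idx k) = z k by rewrite /idx; case: pickP => [j /eqP|].
pose r k := if z k is Some _ then rshift 1 (idx k) else lshift m ord0.
have valr x y k : tnth (with_params x y) (r k) =
    if z k is Some _ then tnth y (idx k) else x.
  by rewrite /r; case: (z k) => [i|]; rewrite ?tnth_rshift ?tnth_lshift.
exists m, (rename phi r); split=> [o|y].
  exists [tuple oapp o d (z k) | k < m] => x; rewrite GP sat_rename.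
  set u := [tuple _ | _ < _]; set w := [tuple _ | _ < _].
  suff -> : u = w by [].
  apply: eq_from_tnth => k; rewrite !tnth_mktuple valr.
  by case E: (z k) => [i|//]; rewrite tnth_mktuple idxP E.
exists (fun i => if [pick j | z j == Some i] is Some j then tnth y j else d) => x.
rewrite GP sat_rename; set u := [tuple _ | _ < _]; set w := [tuple _ | _ < _].
suff -> : u = w by [].
apply: eq_from_tnth => k; rewrite !tnth_mktuple valr /idx.
case E: (z k) => [i|//] /=.
by case: pickP => [//|/(_ k)]; rewrite E eqxx.
Qed.

Variables p q : em_type L.
Hypotheses (hp : S_EM M p) (hq : S_EM M q) (pq : le_div M p q).

Definition condition := {k : nat & (formula L k * k.-tuple (nat * nat))%type}.

(** Requiring the imposed conditions says that all paths realize [q] and that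
    the rows with index in [R] realize [p]; choosing one cell in each of
    finitely many rows amounts to taking cells with increasing first
    coordinates. *)
Definition imposed (R : nat -> Prop) (c : condition) : Prop :=
  (q (projT2 c).1 /\ sorted ltn (map fst (projT2 c).2)) \/
  [/\ p (projT2 c).1, sorted ltn (map snd (projT2 c).2) &
      exists2 i, R i & forall t, t \in (projT2 c).2 -> t.1 = i].

Definition meets (R : nat -> Prop) (c : condition) (A : nat * nat -> M) : Prop :=
  imposed R c -> sat (projT2 c).1 [tuple of map A (projT2 c).2].

Lemma array_compactness (R : nat -> Prop) :
  (forall l : seq {classic condition}, exists A, forall c, c \in l -> meets R c A) ->
  exists A, forall c, meets R c A.
Proof.
move=> H; have [d] := carrier_nonempty M.
pose F (l : seq {classic condition}) A := forall c, c \in l -> meets R c A.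
have [||||A [_ FA]] := @compactness L M K hM _ _ F _ _ _ pred0 (fun=> d).
- exact: (inhabits [::]).
- move=> l; apply: definable_all => c; apply: definable_guard.
  exact: definable_sat.
- move=> l1 l2; exists (l1 ++ l2) => A FA.
  by split=> c cl; apply: FA; rewrite mem_cat cl ?orbT.
- by move=> l; have [A HA] := H l; exists A.
by exists A => c; apply: (FA [:: (c : {classic condition})]); rewrite mem_head.
Qed.

(** The inductive step: see the description of [psi] at the top.  It suffices
    to meet finitely many conditions, those of [l], which is what makes [psi] a
    formula. *)
Lemma add_row n (A : nat * nat -> M) :
  (forall c, meets (fun i => i < n) c A) ->
  forall l : seq {classic condition},
  exists A', forall c, c \in l -> meets (fun i => i < n.+1) c A'.
Proof.
move=> HA l.
(* All cells of row [n] are read as the distinguished variable. *)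
pose h (t : nat * nat) := if t.1 == n then None else Some t.
pose G (o : option (nat * nat) -> M) := forall c : {classic condition}, c \in l ->
  imposed (fun i => i < n) c ->
  sat (projT2 c).1 [tuple of map o [tuple of map h (projT2 c).2]].
have /split_variable[m [psi [toy ofy]]] : definable G.
  apply: definable_all => c; apply: definable_guard; exact: definable_sat.
have qpsi : cl_div M q (existT _ m psi).
  exists (fun i => A (n + i, 0)).
    apply: realizes_of_sat => // k phi s qphi ss.
    have /HA : imposed (fun i => i < n)
        (existT _ k (phi, [tuple of map (fun i => (n + i, 0)) s])).
      left; split=> //=; rewrite -map_comp.
      by apply: homo_sorted ss => x y /=; rewrite ltn_add2l.
    by congr (sat _ _); apply: val_inj; rewrite /= -map_comp.
  apply: (common_solution hM) => N.
  (* Moving the later rows by [N] makes room for the candidates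
     [A (n + i, 0)], [i < N], between them and the rows below [n]. *)
  have [y yP] := toy (fun t : nat * nat => if t.1 < n then A t else A (t.1 + N, t.2)).
  exists y => i iN; apply/yP => -[k [phi v]] cl /= imp.
  pose g (t : nat * nat) := if t.1 < n then t else
    if t.1 == n then (n + i, 0) else (t.1 + N, t.2).
  suff /HA : imposed (fun i => i < n) (existT _ k (phi, [tuple of map g v])).
    congr (sat _ _); apply: val_inj; rewrite /= -!map_comp; apply: eq_map => t /=.
    rewrite /h /g; have [->|_] := eqVneq t.1 n; first by rewrite ltnn.
    by rewrite /=; case: ifP.
  case: imp => /= [[qphi ss]|[pphi ss [j jn vj]]]; [left|right].
    split=> //=; rewrite -map_comp.
    pose g1 r := if r < n then r else if r == n then n + i else r + N.
    have -> : [seq (fst \o g) t | t <- v] = map g1 (map fst v).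
      rewrite -map_comp; apply: eq_map => t /=.
      by rewrite /g /g1; case: ifP => // _; case: ifP.
    by apply: homo_sorted ss => x y'; rewrite /g1; do 4!try case: ifP; lia.
  have -> : [tuple of map g v] = v.
    apply: val_inj; rewrite /= -[RHS]map_id; apply/eq_in_map => t /vj tj.
    by rewrite /g tj jn.
  by split=> //; exists j.
have [a ra [y Hy]] := pq qpsi.
have [o oP] := ofy y.
have Go j : G (oapp o (a j)) by apply/oP; exact: Hy.
pose A' (t : nat * nat) := if t.1 == n then a t.2 else o t.
exists A' => -[k [phi v]] cl.
(* Conditions already imposed for [n] rows only see [psi], once the cells of
   row [n] that they mention carry a single element [a j]. *)
have old j : (forall t, t \in v -> t.1 = n -> a t.2 = a j) ->
    imposed (fun i => i < n) (existT _ k (phi, v)) ->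
    sat phi [tuple of map A' v].
  move=> vj imp; have := Go j _ cl imp; rewrite /=.
  congr (sat _ _); apply: val_inj; rewrite /= -map_comp.
  apply/eq_in_map => t tv; rewrite /= /h /A'.
  by case: eqP => //= /(vj _ tv).
case=> /= [[qphi ss]|[pphi ss [i iSn vi]]].
  (* The cells lie in different rows, so at most one of them is in row [n]. *)
  have [[t0 [t0v t0n]]|no] := pselect (exists t, t \in (v : seq _) /\ t.1 = n).
    apply: (old t0.2) => [t tv tn|]; last by left.
    congr (a _.2); apply: contrapT; move: (ss).
    rewrite ltn_sorted_uniq_leq => /andP[uv _] ne; apply: ne.
    have tsame := nth_index (0, 0) tv; have t0same := nth_index (0, 0) t0v.
    rewrite -tsame -t0same; congr nth; apply/eqP.
    rewrite -(nth_uniq 0 _ _ uv) ?size_map ?index_mem //.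
    by rewrite !(nth_map (0, 0)) ?index_mem // tsame t0same tn t0n.
  by apply: (old 0) => [t tv tn|]; [case: no; exists t | left].
have [i_n|i_n] := eqVneq i n; last first.
  apply: (old 0) => [t /vi -> /eqP|]; first by rewrite (negbTE i_n).
  by right; split=> //; exists i => //; rewrite ltn_neqAle i_n.
move/(realizes_sat phi ra (s := [tuple of map snd v]) ss): pphi.
congr (sat _ _); apply: val_inj; rewrite /= -map_comp.
by apply/eq_in_map => t /vi; rewrite /A' i_n => ->; rewrite eqxx.
Qed.

Lemma finitely_many_rows n :
  exists A : nat * nat -> M, forall c, meets (fun i => i < n) c A.
Proof.
elim: n => [|n [A HA]]; last exact/array_compactness/(add_row HA).
have [b rb] := hq; exists (fun t => b t.1) => -[k [phi v]] /=.
case=> /= [[qphi ss]|[_ _ []//]].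
move/(realizes_sat phi rb (s := [tuple of map fst v]) ss): qphi.
by congr (sat _ _); apply: val_inj; rewrite /= -map_comp.
Qed.

Lemma le_div_sharp : le_sharp M p q.
Proof.
have [|A HA] := @array_compactness (fun=> True).
  move=> l.
  have [n nP] : exists n, forall c : {classic condition}, c \in l ->
      imposed (fun=> True) c -> imposed (fun i => i < n) c.
    elim: l => [|c l [n nP]]; first by exists 0.
    have [[i [_ H]]|no] := pselect (exists i, imposed (fun=> True) c /\
        imposed (fun j => j < i) c).
      exists (maxn n i) => c'; rewrite in_cons => /predU1P[-> _|].
        case: H => [H|[pc sc [j ji vj]]]; [by left|right].
        by split=> //; exists j => //; lia.
      move=> /nP{}nP /nP[?|[pc sc [j ji vj]]]; [by left|right].
      by split=> //; exists j => //; lia.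
    exists n => c'; rewrite in_cons => /predU1P[->|/nP//] imp.
    case: no; case: (imp) => [?|[pc sc [j _ vj]]].
      by exists 0; split=> //; left.
    by exists j.+1; split=> //; right; split=> //; exists j.
  have [A HA] := finitely_many_rows n.
  by exists A => c cl /nP - /(_ cl); exact: HA.
exists (fun i j => A (i, j)); split=> [i|f]; apply: realizes_of_sat => // k phi s.
  move=> pphi ss.
  have /HA : imposed (fun=> True) (existT _ k (phi, [tuple of map (pair i) s])).
    right; split=> //=; first by rewrite -map_comp map_id.
    by exists i => // t /mapP[j _ ->].
  by congr (sat _ _); apply: val_inj; rewrite /= -map_comp.
move=> qphi ss.
have /HA : imposed (fun=> True)
    (existT _ k (phi, [tuple of map (fun i => (i, f i)) s])).
  by left; split=> //=; rewrite -map_comp map_id.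
by congr (sat _ _); apply: val_inj; rewrite /= -map_comp.
Qed.

End DivToSharp.

(** * A TP2 pattern from a failure of inclusion *)

Section SharpToDiv.
Variables (L : language) (M : structure L) (K : Type).
Hypothesis hM : monster M K.

(** If [psi] is outside [cl_div p], then compactness gives an [N] such that the
    first [N] terms of a realization of [p] have no common solution; this [N]
    witnesses inconsistency in every row at once, as all rows realize [p]. *)
Lemma le_sharp_div p q : NTP2 M -> le_sharp M p q -> le_div M p q.
Proof.
move=> ntp [a [rowp pathq]] [m psi] qpsi; apply: contrapT => npsi.
have [N noN] : exists N, ~ exists y : m.-tuple M,
    forall i, i < N -> sat psi (with_params (a 0 i) y).
  apply: contrapT => /forallNP H; apply: npsi; exists (a 0) => //.
  by apply: (common_solution hM) => N; apply: contrapT; exact: H.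
pose r (k : 'I_(1 + m)) : 'I_(m + 1) :=
  match fintype.split k with inl i => rshift m i | inr j => lshift 1 j end.
have swap (y : m.-tuple M) (x : M) :
    sat (rename psi r) [tuple of y ++ [tuple x]] <-> sat psi (with_params x y).
  rewrite sat_rename; set u := [tuple _ | _ < _].
  suff -> : u = with_params x y by [].
  apply: eq_from_tnth => k; rewrite tnth_mktuple /r.
  by case: split_ordP => j ->; rewrite ?tnth_lshift ?tnth_rshift ?tnth_lshift.
apply: (ntp m 1 (rename psi r)); exists (fun i j => [tuple a i j]), N; split.
  move=> i s us [y Hy]; apply: noN.
  have [theta thP] := exists_common M psi N.
  (* Indiscernibility concerns increasing indices; common solutions ignore the
     order, so the distinct indices in [s] may be sorted. *)
  have ss : sorted ltn (sort_tuple leq s).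
    by rewrite ltn_sorted_uniq_leq sort_uniq us sort_sorted //; exact: leq_total.
  have srt : sorted ltn (iota_tuple N 0) := iota_ltn_sorted 0 N.
  have : sat theta [tuple of map (a i) (sort_tuple leq s)].
    apply/thP; exists y => l; rewrite tnth_map.
    have : tnth (sort_tuple leq s) l \in s by rewrite -(mem_sort leq) mem_tnth.
    by move=> /tnthP[l' ->]; apply/swap; exact: Hy.
  move=> /(realizes_sat theta (rowp i) ss) /(realizes_sat theta (rowp 0) srt).
  move=> /thP[y' Hy']; exists y' => j jN; have := Hy' (Ordinal jN).
  by rewrite tnth_map (tnth_nth 0) /= nth_iota.
move=> f; have [y Hy] := cl_div_any hM (pathq f) qpsi.
by exists y => i; apply/swap.
Qed.

End SharpToDiv.

Theorem proposition4p5 (L : language) (T : theory L) (hT : complete_theory T)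
    (K : Type) (M : structure L) (hM : monster M K) (MT : models M T)
    (p q : em_type L) (hp : S_EM M p) (hq : S_EM M q) :
  (le_div M p q -> le_sharp M p q) /\
  (NTP2 M -> le_sharp M p q -> le_div M p q).
Proof.
split=> [pq|ntp pq]; first exact: (le_div_sharp hM hp hq pq).
exact: (le_sharp_div hM ntp pq).
Qed.
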